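(* For every integer $n\geq 1$, $$cr(K_n\times P_2)\leq \left\lfloor\frac{n}{2}\right\rfloor\left\lfloor\frac{n-1}{2}\right\rfloor\left\lfloor\frac{n-2}{2}\right\rfloor\left\lfloor\frac{n-3}{2}\right\rfloor .$$
   Context: The crossing number $cr(G)$ of a graph $G$ is the smallest number of pairwise crossings of edges among all drawings of $G$ in the plane. The Kronecker product $G\times H$ of graphs $G$ and $H$ has vertex set $V(G)\times V(H)$ and edge set $\{\{(a,x),(b,y)\} : \{a,b\}\in E(G),\ \{x,y\}\in E(H)\}$. $K_n$ is the complete graph on $n$ vertices and $P_2$ is the path on $2$ vertices (a single edge). *)

(* Defs.v *)
From HB Require Import structures.
From mathcomp Require Import all_boot all_order all_algebra.
From mathcomp Require Import all_classical all_reals all_analysis.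

Set Implicit Arguments.
Unset Strict Implicit.
Unset Printing Implicit Defensive.

Import Order.TTheory GRing.Theory Num.Theory.
Import numFieldNormedType.Exports.

Local Open Scope classical_set_scope.
Local Open Scope ring_scope.

Record sgraph := SGraph {
  vertex :> finType;
  adj : rel vertex;
  adj_sym : symmetric adj;
  adj_irr : irreflexive adj }.

Definition edges (G : sgraph) : {set {set G}} :=
  [set [set p.1; p.2] | p : G * G & adj p.1 p.2]%SET.

Lemma complete_sym n : symmetric (fun i j : 'I_n => i != j).
Proof. by move=> i j; rewrite eq_sym. Qed.

Lemma complete_irr n : irreflexive (fun i j : 'I_n => i != j).
Proof. by move=> i; rewrite eqxx. Qed.

Definition complete_graph (n : nat) : sgraph :=
  SGraph (@complete_sym n) (@complete_irr n).

Lemma path_sym n :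
  symmetric (fun i j : 'I_n => (i.+1 == j :> nat) || (j.+1 == i :> nat)).
Proof. by move=> i j; rewrite orbC. Qed.

Lemma path_irr n :
  irreflexive (fun i j : 'I_n => (i.+1 == j :> nat) || (j.+1 == i :> nat)).
Proof. by move=> i; rewrite orbb gtn_eqF. Qed.

(* The path with n vertices (hence n - 1 edges). *)
Definition path_graph (n : nat) : sgraph :=
  SGraph (@path_sym n) (@path_irr n).

Section Kronecker.
Variables G H : sgraph.

Definition kronecker_adj : rel (G * H)%type :=
  fun p q => adj p.1 q.1 && adj p.2 q.2.

Lemma kronecker_sym : symmetric kronecker_adj.
Proof. by move=> p q; rewrite /kronecker_adj adj_sym [adj p.2 _]adj_sym. Qed.

Lemma kronecker_irr : irreflexive kronecker_adj.
Proof. by move=> p; rewrite /kronecker_adj adj_irr. Qed.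

Definition kronecker : sgraph := SGraph kronecker_sym kronecker_irr.

End Kronecker.

Section Drawings.
Variable R : realType.

Definition open_square : set (R * R) := `]-1, 1[ `*` `]-1, 1[.

(* A and B cross (rather than touch) at p: a homeomorphism h, with inverse k,
   from a neighbourhood U of p onto an open square straightens A and B to the
   two axes; p, being on both A and B, is sent to the origin. *)
Definition crosses_at (A B : set (R * R)) (p : R * R) : Prop :=
  [/\ A p, B p &
  exists (U : set (R * R)) (h k : R * R -> R * R),
    [/\ open U, U p & h @` U = open_square] /\
    [/\ {within U, continuous h},
        {within open_square, continuous k} &
        forall q, U q -> k (h q) = q] /\
    h @` (A `&` U) = [set z | open_square z /\ z.2 = 0] /\
    h @` (B `&` U) = [set z | open_square z /\ z.1 = 0]].

Variable G : sgraph.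

(* The curve [curve e], parametrized by [0, 1], draws the edge e; its values for
   e outside [edges G] are irrelevant. *)
Record drawing := Drawing {
  pt : G -> R * R;
  curve : {set G} -> R -> R * R;
  pt_inj : injective pt;
  curve_continuous : forall e, e \in edges G ->
    {within `[0, 1], continuous (curve e)};
  curve_injective : forall e, e \in edges G ->
    {in `[0, 1] &, injective (curve e)};
  curve_ends : forall e, e \in edges G ->
    [set curve e 0; curve e 1] = [set pt v | v in [set` e]];
  curve_avoids_vertices : forall e v (t : R), e \in edges G ->
    t \in `]0, 1[ -> curve e t <> pt v;
  curve_transversal : forall e f p, e \in edges G -> f \in edges G -> e != f ->
    (curve e @` `]0, 1[) p -> (curve f @` `]0, 1[) p ->
    crosses_at (curve e @` `]0, 1[) (curve f @` `]0, 1[) p;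
  curve_no_triple : forall e f g p,
    e \in edges G -> f \in edges G -> g \in edges G ->
    e != f -> e != g -> f != g ->
    (curve e @` `]0, 1[) p -> (curve f @` `]0, 1[) p ->
    ~ (curve g @` `]0, 1[) p }.

(* A crossing is an unordered pair of distinct edges with a common point that
   is interior to both; edges may cross several times, and edges with a common
   end vertex may cross. *)
Definition crossings (D : drawing) : set ({set {set G}} * (R * R)) :=
  [set c | exists e f, [/\ e \in edges G, f \in edges G & e != f] /\
    [/\ c.1 = [set e; f]%SET,
        (curve D e @` `]0, 1[) c.2 & (curve D f @` `]0, 1[) c.2]].

(* Drawings with infinitely many crossings do not contribute. The infimum is
   over natural numbers, so it is attained when finite; it would be +oo only
   for a graph with no drawing having finitely many crossings. *)
Definition cr : \bar R :=
  ereal_inf [set k%:R%:E | k in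
    [set k : nat | exists D : drawing, (crossings D #= `I_k)%card]].

End Drawings.

(* Main.v *)
(* Let [x_i = (1, t_i, t_i^2)] for rapidly growing [t_0 < t_1 < ...]. Draw the
   vertex [(i, b)] on the sphere as the ray [(-1)^(i+b) x_i], every edge as the
   great-circle arc between its ends, and project stereographically to the plane;
   the two copies of a vertex of K_n are antipodal. Two edges meet exactly when
   the linear dependency between the rays of their four ends has a suitable sign
   pattern. As the signs of the dependency between [x_i, x_j, x_k, x_l] with
   [i < j < k < l] alternate, this only depends on the parities of [i, j, k, l]:
   six parity words give four crossings each, the other ten none. Summing over
   all [i < j < k < l] gives exactly the product in the bound. The growth of [t]
   excludes triple points, and linear coordinates of space adapted to a crossing
   straighten both arcs. *)
Require Import Defs.
From mathcomp Require Import all_boot all_order all_algebra.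
From mathcomp Require Import all_classical all_reals all_analysis.
From mathcomp Require Import zify ring lra.

Import Order.TTheory GRing.Theory Num.Theory.
Import numFieldNormedType.Exports.

Set Implicit Arguments.
Unset Strict Implicit.
Unset Printing Implicit Defensive.

(** * Counting parity words *)

Section Counting.
Local Open Scope nat_scope.

(** The six words have the shapes [aaaa], [aabb] and [abba]; excluded are [abab] and the eight words
    with an odd number of ones. *)
Definition good4 (a b c d : bool) : bool :=
  [|| [&& a == b, b == c & c == d], [&& a == b, b != c & c == d]
    | [&& a == d, a != b & b == c]].

(** Each count fixes the letters of the larger indices, so raising the bound by one adds a single
    term of the count one level below. *)
Let cnt1 b c d n := \sum_(i < n) good4 (odd i) b c d.
Let cnt2 c d n := \sum_(x < n) cnt1 (odd x) c d x.
Let cnt3 d n := \sum_(y < n) cnt2 (odd y) d y.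
Let cnt4 n := \sum_(z < n) cnt3 (odd z) z.

Let cnt1S b c d n : cnt1 b c d n.+1 = cnt1 b c d n + good4 (odd n) b c d.
Proof. exact: big_ord_recr. Qed.
Let cnt2S c d n : cnt2 c d n.+1 = cnt2 c d n + cnt1 (odd n) c d n.
Proof. exact: big_ord_recr. Qed.
Let cnt3S d n : cnt3 d n.+1 = cnt3 d n + cnt2 (odd n) d n.
Proof. exact: big_ord_recr. Qed.
Let cnt4S n : cnt4 n.+1 = cnt4 n + cnt3 (odd n) n.
Proof. exact: big_ord_recr. Qed.

Let cnt1_double b c d m :
  cnt1 b c d m.*2 = m * (good4 false b c d + good4 true b c d).
Proof.
elim: m => [|m IH]; first by rewrite /cnt1 big_ord0.
by rewrite doubleS !cnt1S IH /= odd_double /=; lia.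
Qed.

(** Equal last letters ask for two indices of equal parity; distinct ones ask for an odd-even or an
    even-odd pair, and these two orders give different binomials. Doubling avoids halves. *)
Let cnt2_double m : [/\ cnt2 false false m.*2 = m * m.-1,
  cnt2 true true m.*2 = m * m.-1,
  (cnt2 false true m.*2).*2 = m * m.-1 & (cnt2 true false m.*2).*2 = m * m.+1].
Proof.
elim: m => [|m [IH1 IH2 IH3 IH4]]; first by rewrite /cnt2 !big_ord0.
rewrite doubleS !cnt2S !cnt1S /= !odd_double /= !cnt1_double /good4 /=.
by split; nia.
Qed.
Let cnt3_double m : (cnt3 false m.*2).*2 = m * m.-1 ^ 2 /\
  (cnt3 true m.*2).*2 = m * m.-1 ^ 2.
Proof.
elim: m => [|m [IH1 IH2]]; first by rewrite /cnt3 !big_ord0.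
have [S1 S2 S3 S4] := cnt2_double m.
rewrite doubleS !cnt3S !cnt2S /= !odd_double /= !cnt1_double /good4 /=.
by split; case: (m) IH1 IH2 S1 S2 S3 S4 => [|k] /=; rewrite -?mulnn; nia.
Qed.

Let cnt4_double m : 4 * cnt4 m.*2 = m * m.-1 ^ 2 * m.-2.
Proof.
elim: m => [|m IH]; first by rewrite /cnt4 !big_ord0.
have [S1 S2 S3 S4] := cnt2_double m.
have [T1 T2] := cnt3_double m.
rewrite doubleS !cnt4S !cnt3S /= !odd_double /=.
by case: (m) IH S1 S2 S3 S4 T1 T2 => [|[|k]] /=; rewrite -?mulnn; nia.
Qed.

Lemma sum_good4 n : 4 * (\sum_(z < n) \sum_(y < z) \sum_(x < y) \sum_(i < x)
    good4 (odd i) (odd x) (odd y) (odd z)) =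
  (n %/ 2) * ((n - 1) %/ 2) * ((n - 2) %/ 2) * ((n - 3) %/ 2).
Proof.
rewrite -[LHS]/(4 * cnt4 n).
have E4 := cnt4_double n./2.
have [E3f E3t] := cnt3_double n./2.
rewrite -[n]odd_double_half; case: (odd n) => /=.
  (* For [n = 2m + 1] the last index [2m] is even and adds [m(m-1)^2/2] words; then
     [m(m-1)^2(m-2) + 2m(m-1)^2 = m^2(m-1)^2]. *)
  rewrite cnt4S odd_double mulnDr E4.
  set m := n./2 in E3f *.
  have -> : (1 + m.*2) %/ 2 = m by lia.
  have -> : (1 + m.*2 - 1) %/ 2 = m by lia.
  have -> : (1 + m.*2 - 2) %/ 2 = m.-1 by lia.
  have -> : (1 + m.*2 - 3) %/ 2 = m.-1 by lia.
  by case: m E3f {E4 E3t} => [|[|k]] /=; rewrite -?mulnn; nia.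
set m := n./2 in E4 *; rewrite add0n E4.
have -> : m.*2 %/ 2 = m by lia.
have -> : (m.*2 - 1) %/ 2 = m.-1 by lia.
have -> : (m.*2 - 2) %/ 2 = m.-1 by lia.
have -> : (m.*2 - 3) %/ 2 = m.-2 by lia.
by rewrite -mulnn; nia.
Qed.

Lemma sum_nested_ord n (F : nat -> nat) m : m <= n ->
  \sum_(i < n) (i < m) * F i = \sum_(i < m) F i.
Proof.
move=> mn; rewrite (big_ord_widen n F mn) [RHS]big_mkcond /=.
by apply: eq_bigr => i _; case: (i < m); rewrite ?mul1n.
Qed.

End Counting.

(** * A rapidly growing sequence *)

Ltac uniq_tac u := move: u; rewrite /= !inE !negb_or ?andbT -?andbA;
  (repeat (case/andP; intro)); intros; repeat (apply/andP; split);
  solve [assumption | by rewrite eq_sym].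

Section Growth.
Local Open Scope ring_scope.

(** Each term is the fourth power of the one before, so it exceeds three times the cube of any
    earlier term; the base 16 leaves room for the constant. *)
Definition tower (i : nat) : int := (16 ^ (4 ^ i))%N.

Lemma towerS i : tower i.+1 = tower i ^+ 4.
Proof. by rewrite /tower expnS mulnC expnM -!natz natrX. Qed.

Lemma tower_gt0 i : 0 < tower i.
Proof. by rewrite /tower ltz_nat expn_gt0. Qed.

Lemma tower_ge16 i : 16 <= tower i.
Proof. by rewrite /tower -[X in X <= _]/(16 ^ 1)%N%:Z lez_nat leq_exp2l ?expn_gt0. Qed.

Lemma tower_lt i j : (tower i < tower j) = (i < j)%N.
Proof. by rewrite /tower ltz_nat !ltn_exp2l. Qed.

Lemma tower_inj : injective tower.
Proof.
move=> i j e; apply/eqP; rewrite eqn_leq leqNgt -tower_lt e ltxx.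
by rewrite leqNgt -tower_lt e ltxx.
Qed.

Lemma tower_le_pred i m : (i < m)%N -> tower i <= tower m.-1.
Proof. by case: m => // m; rewrite ltnS leNgt tower_lt -leqNgt. Qed.

(** By integrality [|t c| >= t], so [e] is too small to cancel [t c]. *)
Lemma dominant_neq0 (t c e : int) : c != 0 -> `|e| < t -> t * c + e != 0.
Proof.
move=> c0 et; apply/eqP => h.
have E : e = - (t * c) by lia.
have c1 : 1 <= `|c| by lia.
have t0 : 0 < t by apply: le_lt_trans et.
by move: et; rewrite E normrN normrM (gtr0_norm t0) ltNge ler_peMr // ltW.
Qed.

(** Meant for polynomials that are linear in their largest parameter, with a remainder of degree at
    most three in the smaller ones. *)
Lemma tower_dominant m (c e : int) : c != 0 ->
  `|e| <= 3 * tower m.-1 ^+ 3 -> (0 < m)%N -> tower m * c + e != 0.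
Proof.
case: m => // m c0 /= he _; apply: dominant_neq0 => //.
rewrite towerS; apply: le_lt_trans he _.
rewrite [_ ^+ 4]exprS ltr_pM2r ?exprn_gt0 ?tower_gt0 //.
by apply: lt_le_trans (tower_ge16 m).
Qed.

Let bnd (T x : int) := 0 <= x <= T.

Let bndM (T S x y : int) : bnd T x -> bnd S y -> bnd (T * S) (x * y).
Proof. by move=> /andP[x0 xT] /andP[y0 yS]; rewrite /bnd mulr_ge0 ?ler_pM. Qed.

Let bnd_tower i m : (i < m)%N -> bnd (tower m.-1) (tower i).
Proof. by move=> im; rewrite /bnd ltW ?tower_gt0 ?tower_le_pred. Qed.

Let pow_tower m : let T := tower m in (1 <= T) && (T <= T * T) &&
  (T * T <= T * (T * T)) && (T ^+ 3 == T * (T * T)).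
Proof.
have T16 := tower_ge16 m; move: (tower m) T16 => T T16 /=.
by rewrite !exprS expr0 mulr1 eqxx; nia.
Qed.

Let max_of_seq (a : nat) (s : seq nat) : exists2 x, x \in a :: s &
  forall y, y \in a :: s -> y != x -> (y < x)%N.
Proof.
elim: s a => [|b s IH] a.
  by exists a; rewrite ?mem_head // => y; rewrite inE => /eqP->; rewrite eqxx.
have [x xs h] := IH b; have [ax|xa|ax] := ltngtP a x.
- exists x; first by rewrite inE xs orbT.
  by move=> y; rewrite inE => /orP[/eqP->//|]; exact: h.
- exists a; first exact: mem_head.
  move=> y; rewrite inE => /orP[/eqP->|ys ya]; first by rewrite eqxx.
  by have [->//|yx] := eqVneq y x; exact: ltn_trans (h y ys yx) xa.
- exists a; first exact: mem_head.
  move=> y; rewrite inE => /orP[/eqP->|ys ya]; first by rewrite eqxx.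
  by rewrite ax; apply: h ys _; rewrite -ax.
Qed.

Ltac max_tac u h := repeat (apply/andP; split); (apply: h;
  [by rewrite !inE eqxx ?orbT | uniq_tac u]).

(** First step of a chain of leading coefficients: [concur] is linear in its largest parameter, with
    a coefficient as in [tower_quadratic_neq], whose own leading coefficient may be a difference of
    two sums. *)
Lemma tower_sum_neq (k l m o : nat) : uniq [:: k; l; m; o] ->
  tower k + tower l != tower m + tower o.
Proof.
have max_first a b c d : [&& b < a, c < a & d < a]%N ->
    tower a + tower b != tower c + tower d.
  case/and3P=> ba ca da; rewrite -subr_eq0.
  rewrite [X in X != _](_ : _ = tower a * 1 + (tower b - tower c - tower d));
    last by ring.
  apply: tower_dominant => //; last exact: leq_ltn_trans ba.
  move: (bnd_tower ba) (bnd_tower ca) (bnd_tower da) (pow_tower a.-1) => /=.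
  by rewrite /bnd; lia.
move=> u; have [x] := max_of_seq k [:: l; m; o].
rewrite 4!inE => /or4P[] /eqP-> h.
- by apply: max_first; max_tac u h.
- by rewrite [tower k + _]addrC; apply: max_first; max_tac u h.
- by rewrite eq_sym; apply: max_first; max_tac u h.
- by rewrite eq_sym [tower m + _]addrC; apply: max_first; max_tac u h.
Qed.

Lemma tower_quadratic_neq (j k l m o : nat) : uniq [:: j; k; l; m; o] ->
  (tower j - tower k) * (tower j - tower l) !=
  (tower j - tower m) * (tower j - tower o).
Proof.
have max_first a b c d e : a != c ->
    [&& a < b, c < b, d < b & e < b]%N ->
    (tower a - tower b) * (tower a - tower c) !=
    (tower a - tower d) * (tower a - tower e).
  move=> ac /and4P[ab cb db eb]; rewrite -subr_eq0.
  rewrite [X in X != _](_ : _ = tower b * (tower c - tower a) +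
    (tower a * tower d + tower a * tower e - tower d * tower e
     - tower a * tower c)); last by ring.
  apply: tower_dominant; last exact: leq_ltn_trans ab.
    by rewrite subr_eq0 (inj_eq tower_inj) eq_sym.
  move: (bndM (bnd_tower ab) (bnd_tower cb)) (bndM (bnd_tower ab) (bnd_tower db))
    (bndM (bnd_tower ab) (bnd_tower eb)) (bndM (bnd_tower db) (bnd_tower eb))
    (pow_tower b.-1) => /=.
  by rewrite /bnd; lia.
move=> u; have [x] := max_of_seq j [:: k; l; m; o].
rewrite 5!inE => /orP[/eqP->|/or4P[] /eqP->] h.
- have /and4P[h1 h2 h3 h4] : [&& k < j, l < j, m < j & o < j]%N by max_tac u h.
  rewrite -subr_eq0.
  (* The squares of [tower j] cancel, which leaves an expression linear in [tower j]. *)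
  rewrite [X in X != _](_ : _ = tower j * (tower m + tower o - (tower k + tower l)) +
    (tower k * tower l - tower m * tower o)); last by ring.
  apply: tower_dominant; last exact: leq_ltn_trans h1.
    by rewrite subr_eq0 tower_sum_neq //; uniq_tac u.
  move: (bndM (bnd_tower h1) (bnd_tower h2)) (bndM (bnd_tower h3) (bnd_tower h4))
    (pow_tower j.-1) => /=.
  by rewrite /bnd; lia.
- by apply: max_first; [uniq_tac u | max_tac u h].
- by rewrite [X in X != _]mulrC; apply: max_first; [uniq_tac u | max_tac u h].
- by rewrite eq_sym; apply: max_first; [uniq_tac u | max_tac u h].
- rewrite eq_sym [X in X != _]mulrC.
  by apply: max_first; [uniq_tac u | max_tac u h].
Qed.

(* Three lines [Z = s_e Y - p_e X] are concurrent when this determinant vanishes;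
   [s_e] and [p_e] are the sum and the product of the two parameters of [e]. *)
Definition concur {K : comNzRingType} (i j k l m o : K) : K :=
  (i + j) * (k * l - m * o) + (k + l) * (m * o - i * j) +
  (m + o) * (i * j - k * l).

Lemma tower_concur_neq0 (i j k l m o : nat) : uniq [:: i; j; k; l; m; o] ->
  concur (tower i) (tower j) (tower k) (tower l) (tower m) (tower o) != 0.
Proof.
have max_first a b c d e f : uniq [:: b; c; d; e; f] ->
    [&& b < a, c < a, d < a, e < a & f < a]%N ->
    concur (tower a) (tower b) (tower c) (tower d) (tower e) (tower f) != 0.
  move=> u /and5P[ba ca da ea fa].
  rewrite [X in X != _](_ : _ = tower a *
    ((tower b - tower c) * (tower b - tower d) -
     (tower b - tower e) * (tower b - tower f)) +
    (tower b * (tower c * tower d) - tower b * (tower e * tower f)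
      + (tower c * (tower e * tower f) + tower d * (tower e * tower f))
      - (tower e * (tower c * tower d) + tower f * (tower c * tower d))));
    last by rewrite /concur; ring.
  apply: tower_dominant; last exact: leq_ltn_trans ba.
    by rewrite subr_eq0 tower_quadratic_neq.
  have cd := bndM (bnd_tower ca) (bnd_tower da).
  have ef := bndM (bnd_tower ea) (bnd_tower fa).
  move: (bndM (bnd_tower ba) cd) (bndM (bnd_tower ba) ef)
    (bndM (bnd_tower ca) ef) (bndM (bnd_tower da) ef)
    (bndM (bnd_tower ea) cd) (bndM (bnd_tower fa) cd) (pow_tower a.-1) => /=.
  by rewrite /bnd; lia.
(* These two symmetries bring the largest parameter to the first place. *)
have swap a b c d e f : concur a b c d e f = concur b a c d e f :> int.
  by rewrite /concur; ring.
have rot a b c d e f : concur a b c d e f = concur c d e f a b :> int.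
  by rewrite /concur; ring.
move=> u; have [x] := max_of_seq i [:: j; k; l; m; o].
rewrite 6!inE => /or3P[/eqP->|/eqP->|/or4P[] /eqP->] h.
- by apply: max_first; [uniq_tac u | max_tac u h].
- by rewrite swap; apply: max_first; [uniq_tac u | max_tac u h].
- by rewrite rot; apply: max_first; [uniq_tac u | max_tac u h].
- by rewrite rot swap; apply: max_first; [uniq_tac u | max_tac u h].
- by rewrite 2!rot; apply: max_first; [uniq_tac u | max_tac u h].
- by rewrite 2!rot swap; apply: max_first; [uniq_tac u | max_tac u h].
Qed.
End Growth.

(** * Stereographic projection *)

Section Stereographic.
Local Open Scope ring_scope.
Local Open Scope classical_set_scope.
Variable R : realType.
Implicit Types (u v w : R * R * R) (q : R * R) (a b c : R).

Definition scale c v : R * R * R := (c * v.1.1, c * v.1.2, c * v.2).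
Definition comb a u b v : R * R * R :=
  (a * u.1.1 + b * v.1.1, a * u.1.2 + b * v.1.2, a * u.2 + b * v.2).
(** Keeps the ray away from the axis through the poles, so that the denominator in [stereo] is
    positive. *)
Definition off_axis v := (v.1.1 != 0) || (v.1.2 != 0).
Definition norm3 v := Num.sqrt (v.1.1 ^+ 2 + v.1.2 ^+ 2 + v.2 ^+ 2).
(** Projection of [v / |v|] from the north pole, in a form that makes sense for vectors that are not
    normalized. *)
Definition stereo v : R * R :=
  (v.1.1 / (norm3 v - v.2), v.1.2 / (norm3 v - v.2)).
(** Inverse projection with its denominator [|q|^2 + 1] cleared: a polynomial choice of a vector on
    the ray above [q]. *)
Definition lift3 q : R * R * R :=
  (2 * q.1, 2 * q.2, q.1 ^+ 2 + q.2 ^+ 2 - 1).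

Lemma norm3_sqr v : norm3 v ^+ 2 = v.1.1 ^+ 2 + v.1.2 ^+ 2 + v.2 ^+ 2.
Proof. by rewrite sqr_sqrtr // !addr_ge0 ?sqr_ge0. Qed.

Lemma norm3_gt v : off_axis v -> v.2 < norm3 v.
Proof.
move=> o; have n0 : 0 <= norm3 v by exact: sqrtr_ge0.
have : v.2 ^+ 2 < norm3 v ^+ 2.
  rewrite norm3_sqr ltrDr; case/orP: o => h.
    by rewrite ltr_pwDl ?sqr_ge0 // exprn_even_gt0.
  by rewrite ltr_pwDr ?sqr_ge0 // exprn_even_gt0.
by nra.
Qed.

Lemma stereo_scale c v : 0 < c -> stereo (scale c v) = stereo v.
Proof.
move=> c0; have E : norm3 (scale c v) = c * norm3 v.
  rewrite /norm3 /scale /= !exprMn -!mulrDr sqrtrM ?sqr_ge0 //.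
  by rewrite sqrtr_sqr gtr0_norm.
rewrite /stereo E /= -mulrBr !invfM.
by congr pair; rewrite mulrACA divff ?gt_eqF // mul1r.
Qed.

Lemma lift3K q : stereo (lift3 q) = q.
Proof.
have E : norm3 (lift3 q) = q.1 ^+ 2 + q.2 ^+ 2 + 1.
  rewrite /norm3 [X in Num.sqrt X](_ : _ = (q.1 ^+ 2 + q.2 ^+ 2 + 1) ^+ 2).
    by rewrite sqrtr_sqr ger0_norm // !addr_ge0 ?sqr_ge0.
  by rewrite /=; ring.
rewrite [RHS]surjective_pairing /stereo E /=.
rewrite (_ : _ - (_ - _) = 2); last by ring.
by congr pair; field.
Qed.

Lemma lift3_stereo v : off_axis v ->
  exists2 c, 0 < c & lift3 (stereo v) = scale c v.
Proof.
move=> o; have := norm3_gt o; rewrite -subr_gt0 => d0.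
(* The factor is dictated by the first coordinate; the third one then agrees because
   [x^2 + y^2 = (|v| - z)(|v| + z)]. *)
exists (2 / (norm3 v - v.2)); first by rewrite divr_gt0.
have n2 := norm3_sqr v.
rewrite /lift3 /scale /stereo /=; congr (_, _, _).
- by rewrite mulrA mulrAC.
- by rewrite mulrA mulrAC.
have X2 : v.1.1 ^+ 2 + v.1.2 ^+ 2 = (norm3 v - v.2) * (norm3 v + v.2).
  by rewrite -subr_sqr n2 addrK.
rewrite !expr_div_n -mulrDl X2; field.
by rewrite gt_eqF.
Qed.

(** Lifting both sides recovers each vector up to a positive factor. *)
Lemma stereo_eq u v : off_axis u -> off_axis v -> stereo u = stereo v ->
  exists2 c, 0 < c & u = scale c v.
Proof.
move=> /lift3_stereo[a a0 ea] /lift3_stereo[b b0 eb] e.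
exists (b / a); first by rewrite divr_gt0.
move: ea; rewrite e eb [u]surjective_pairing [u.1]surjective_pairing.
have an : a != 0 by rewrite gt_eqF.
rewrite /scale /= => -[e1 e2 e3].
by congr (_, _, _); rewrite mulrAC (e1, e2, e3) mulrC mulKf.
Qed.

Lemma stereo_cts (T : topologicalType) (x y z : T -> R) (t : T) :
  {for t, continuous x} -> {for t, continuous y} -> {for t, continuous z} ->
  off_axis (x t, y t, z t) ->
  {for t, continuous (fun s => stereo (x s, y s, z s))}.
Proof.
move=> xc yc zc o.
have dc : {for t, continuous (fun s => (norm3 (x s, y s, z s) - z s)^-1)}.
  apply: cvgV; first by rewrite gt_eqF // subr_gt0; exact: (norm3_gt o).
  apply: cvgB => //.
  apply: (@continuous_comp _ _ _ (fun s => x s ^+ 2 + y s ^+ 2 + z s ^+ 2) Num.sqrt);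
    last exact: sqrt_continuous.
  have sq (f : T -> R) : {for t, continuous f} ->
      {for t, continuous (fun s => f s ^+ 2)}.
    by move=> fc; apply: (continuousM fc fc).
  by apply: cvgD; [apply: cvgD|]; apply: sq.
exact: (cvg_pair (continuousM xc dc) (continuousM yc dc)).
Qed.

End Stereographic.

(** * Great-circle arcs and their transversal crossings *)

Section Arcs.
Local Open Scope ring_scope.
Local Open Scope classical_set_scope.
Variable R : realType.
Implicit Types (u v w n : R * R * R) (p q z : R * R) (a b c : R).

Definition dot u v := u.1.1 * v.1.1 + u.1.2 * v.1.2 + u.2 * v.2.
Definition cross u v : R * R * R :=
  (u.1.2 * v.2 - u.2 * v.1.2, u.2 * v.1.1 - u.1.1 * v.2,
   u.1.1 * v.1.2 - u.1.2 * v.1.1).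

Definition arc u v : set (R * R) :=
  [set q | exists a b, [/\ 0 < a, 0 < b & q = stereo (comb a u b v)]].

Lemma arc_segment u v :
  (fun t : R => stereo (comb (1 - t) u t v)) @` `]0, 1[ = arc u v.
Proof.
apply/seteqP; split=> q /=.
  move=> [t]; rewrite in_itv /= => /andP[t0 t1] <-.
  by exists (1 - t), t; rewrite subr_gt0.
move=> [a [b [a0 b0 ->]]]; have ab : 0 < a + b by rewrite addr_gt0.
exists (b / (a + b)).
  by rewrite in_itv /= divr_gt0 //= ltr_pdivrMr // mul1r ltrDr.
rewrite -[RHS](@stereo_scale _ (a + b)^-1) ?invr_gt0 //; congr stereo.
have abn : a + b != 0 by rewrite gt_eqF.
by rewrite /comb /scale /=; congr (_, _, _); field.
Qed.

Lemma dot_lift3_cts n : continuous (fun q => dot (lift3 q) n).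
Proof.
have c1 : continuous (fun q : R * R => q.1) by move=> q; exact: cvg_fst.
have c2 : continuous (fun q : R * R => q.2) by move=> q; exact: cvg_snd.
have cst a : continuous (fun _ : R * R => a) by move=> q; exact: cvg_cst.
have cM (f g : R * R -> R) : continuous f -> continuous g ->
    continuous (fun q => f q * g q).
  by move=> fc gc q; exact: continuousM (fc q) (gc q).
have cD (f g : R * R -> R) : continuous f -> continuous g ->
    continuous (fun q => f q + g q).
  by move=> fc gc q; exact: continuousD (fc q) (gc q).
rewrite /dot /lift3 /=.
apply: (cD); [apply: (cD); apply: (cM) => //; exact: (cM)|apply: (cM) => //].
by apply: (cD) => //; apply: (cD); [exact: (cM _ _ c1 c1)|exact: (cM _ _ c2 c2)].
Qed.

(** The common point lifts to [P], and the determinant hypothesis makes [P], [u1], [w1] a basis of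
    space. The first arc lies where the [w1] coordinate vanishes, the second where the [u1]
    coordinate does, and dividing by the [P] coordinate gives the straightening chart. *)
Lemma arcs_cross u1 u2 w1 w2 p :
  (forall a b, 0 < a -> 0 < b -> off_axis (comb a u1 b u2)) ->
  (forall a b, 0 < a -> 0 < b -> off_axis (comb a w1 b w2)) ->
  dot u1 (cross u2 w1) != 0 -> arc u1 u2 p -> arc w1 w2 p ->
  crosses_at (arc u1 u2) (arc w1 w2) p.
Proof.
move=> offu offw D0 pA pB; split => //.
have [a [b [a0 b0 pE]]] := pA.
have [c' [d' [c'0 d'0 pE']]] := pB.
have [l l0 PE] := stereo_eq (offu _ _ a0 b0) (offw _ _ c'0 d'0)
  (etrans (esym pE) pE').
set P := comb a u1 b u2 in pE PE.
have {}PE : exists c d, [/\ 0 < c, 0 < d & P = comb c w1 d w2].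
  exists (l * c'), (l * d'); rewrite !mulr_gt0 //; split=> //.
  by rewrite PE /scale /comb /=; congr (_, _, _); ring.
have [c [d [c0 d0 {}PE]]] := PE.
have offP : off_axis P by exact: offu.
clear l l0 c' d' c'0 d'0 pE' pA pB.
(* The determinant of the basis; expanding [P] leaves only its [u2] term. *)
pose Dl := dot P (cross u1 w1).
have Dl0 : Dl != 0.
  rewrite (_ : Dl = - (b * dot u1 (cross u2 w1))).
    by rewrite oppr_eq0 mulf_neq0 // gt_eqF.
  by rewrite /Dl /P /dot /cross /comb /=; ring.
pose m := `|P.1.1| + `|P.1.2|.
have m0 : 0 < m.
  case/orP: offP => h; first by rewrite ltr_pwDl ?normr_gt0.
  by rewrite ltr_pwDr ?normr_gt0.
pose K := `|u1.1.1| + `|w1.1.1| + (`|u1.1.2| + `|w1.1.2|).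
have K0 : 0 <= K by rewrite !addr_ge0.
(* [e < a] and [e < c] keep [a + e x] and [c + e y] positive, so that perturbed points stay on the
   arcs; [e K < m] keeps the perturbations of [P] off the axis. *)
have [e [e0 ea ec eK]] : exists e, [/\ 0 < e, e < a, e < c & e * K < m].
  pose e := Num.min (Num.min a c) (m / (K + 1)) / 2.
  have K1 : 0 < K + 1 by rewrite ltr_wpDl.
  have M0 : 0 < Num.min (Num.min a c) (m / (K + 1)).
    by rewrite !lt_min a0 c0 divr_gt0.
  have h : e < Num.min (Num.min a c) (m / (K + 1)) by rewrite /e; lra.
  move: (h); rewrite !lt_min ltr_pdivlMr // => /andP[/andP[ea ec] em].
  have ee : 0 < e by rewrite divr_gt0.
  by exists e; split=> //; apply: le_lt_trans em; rewrite ler_pM2l // lerDl.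
pose pert x y := comb 1 (comb 1 P (e * x) u1) (e * y) w1.
have off_pert x y : -1 < x < 1 -> -1 < y < 1 -> off_axis (pert x y).
  move=> hx hy; rewrite /off_axis -negb_and; apply/negP.
  rewrite /pert /comb /= !mul1r => /andP[/eqP e1 /eqP e2].
  have nx : `|x| <= 1 by rewrite ler_norml; lra.
  have ny : `|y| <= 1 by rewrite ler_norml; lra.
  have bd (X U W : R) : X + e * x * U + e * y * W = 0 ->
      `|X| <= e * (`|U| + `|W|).
    move=> h; have -> : X = - (e * (x * U + y * W)).
      by rewrite -[RHS]add0r -h; ring.
    rewrite normrN normrM (gtr0_norm e0) ler_pM2l //.
    apply: le_trans (ler_normD _ _) _; rewrite !normrM.
    by apply: lerD; rewrite ler_piMl.
  have := lerD (bd _ _ _ e1) (bd _ _ _ e2).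
  by rewrite -mulrDr -/K -/m leNgt eK.
(* Cramer's rule: the coordinates along [P], [u1] and [w1]. *)
pose ga v := dot v (cross u1 w1) / Dl.
pose al v := dot v (cross w1 P) / Dl.
pose be v := dot v (cross P u1) / Dl.
have gaZ k v : ga (scale k v) = k * ga v.
  by rewrite /ga /dot /scale /=; field.
have alZ k v : al (scale k v) = k * al v.
  by rewrite /al /dot /scale /=; field.
have beZ k v : be (scale k v) = k * be v.
  by rewrite /be /dot /scale /=; field.
have DlE : Dl = dot P (cross u1 w1) by [].
have ga_pert x y : ga (pert x y) = 1.
  rewrite /ga (_ : dot _ _ = Dl) ?divff //.
  by rewrite DlE /pert /dot /cross /comb /=; ring.
have al_pert x y : al (pert x y) = e * x.
  rewrite /al (_ : dot _ _ = e * x * Dl); first exact: mulfK.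
  by rewrite DlE /pert /dot /cross /comb /=; ring.
have be_pert x y : be (pert x y) = e * y.
  rewrite /be (_ : dot _ _ = e * y * Dl); first exact: mulfK.
  by rewrite DlE /pert /dot /cross /comb /=; ring.
have basis v : v = comb (ga v) P 1 (comb (al v) u1 (be v) w1).
  have div x y : Dl * x = y -> x = y / Dl by move=> <-; rewrite mulrC mulKf.
  rewrite [LHS]surjective_pairing [v.1]surjective_pairing /comb /ga /al /be /=.
  congr (_, _, _); rewrite !mul1r -!(mulrAC _ _ Dl^-1) -!mulrDl; apply: div;
    by rewrite DlE /P /dot /cross /=; ring.
have be_u s t : be (comb s u1 t u2) = 0.
  rewrite /be (_ : dot _ _ = 0) ?mul0r //.
  by rewrite /P /dot /cross /comb /=; ring.
have al_w s t : al (comb s w1 t w2) = 0.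
  rewrite /al (_ : dot _ _ = 0) ?mul0r //.
  by rewrite PE /dot /cross /comb /=; ring.
have cga : continuous (ga \o @lift3 R).
  move=> q; exact: continuousM (@dot_lift3_cts _ q) (cvg_cst _).
have cal : continuous (al \o @lift3 R).
  move=> q; exact: continuousM (@dot_lift3_cts _ q) (cvg_cst _).
have cbe : continuous (be \o @lift3 R).
  move=> q; exact: continuousM (@dot_lift3_cts _ q) (cvg_cst _).
move: (ga) (al) (be) gaZ alZ beZ ga_pert al_pert be_pert basis be_u al_w cga cal cbe
  => {ga al be} ga al be gaZ alZ beZ ga_pert al_pert be_pert basis be_u al_w cga cal cbe.
have pertP : pert 0 0 = P.
  by rewrite /pert /P /comb /=; congr (_, _, _); ring.
have pert_u x : pert x 0 = comb (a + e * x) u1 b u2.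
  by rewrite /pert /P /comb /=; congr (_, _, _); ring.
have pert_w y : pert 0 y = comb (c + e * y) w1 d w2.
  by rewrite /pert PE /comb /=; congr (_, _, _); ring.
(* The conditions [|al| < e ga] and [|be| < e ga] say that [h] lands in the open square; written
   without division they are visibly open and force [ga > 0]. *)
pose U := [set q | [/\ 0 < e * ga (lift3 q) - al (lift3 q),
  0 < e * ga (lift3 q) + al (lift3 q), 0 < e * ga (lift3 q) - be (lift3 q)
  & 0 < e * ga (lift3 q) + be (lift3 q)]].
pose h q := (al (lift3 q) / (e * ga (lift3 q)), be (lift3 q) / (e * ga (lift3 q))).
pose k z := stereo (pert z.1 z.2).
have sqE z : open_square z <-> (-1 < z.1 < 1) /\ (-1 < z.2 < 1).
  by rewrite /open_square /= !in_itv.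
have Uga q : U q -> 0 < e * ga (lift3 q).
  by rewrite /U /=; case=> h1 h2 _ _; move: h1 h2; clear; lra.
have off_k z : open_square z -> off_axis (pert z.1 z.2).
  by case/sqE=> z1 z2; exact: off_pert.
have kU z : open_square z -> U (k z).
  move=> zs; have [l l0 E] := lift3_stereo (off_k z zs).
  rewrite /U /= /k E gaZ alZ beZ ga_pert al_pert be_pert.
  have le0 : 0 < l * e by rewrite mulr_gt0.
  have sm x y : - 1 < y -> x = l * e * (1 + y) -> 0 < x.
    by move=> y1 ->; rewrite mulr_gt0 // -ltrBlDl sub0r.
  move/sqE: zs => [/andP[x1 x2] /andP[y1 y2]]; split.
  - by apply: (sm _ (- z.1)); [rewrite ltrN2|ring].
  - by apply: (sm _ z.1); [|ring].
  - by apply: (sm _ (- z.2)); [rewrite ltrN2|ring].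
  - by apply: (sm _ z.2); [|ring].
have kK z : open_square z -> h (k z) = z.
  move=> zs; have [l l0 E] := lift3_stereo (off_k z zs).
  rewrite /h /k E gaZ alZ beZ ga_pert al_pert be_pert [RHS]surjective_pairing.
  by congr pair; field; rewrite !gt_eqF.
have hsq q : U q -> open_square (h q).
  move=> Uq; have g0 := Uga _ Uq; case: Uq => ? ? ? ?.
  by apply/sqE; rewrite /h /= !ltr_pdivrMr // !ltr_pdivlMr //; lra.
have hK q : U q -> k (h q) = q.
  (* Dividing [lift3 q] by its [P] coordinate puts it in the form [pert x y]. *)
  move=> /Uga g0; rewrite /k -[RHS]lift3K.
  have g1 : 0 < ga (lift3 q) by rewrite -(pmulr_rgt0 _ e0).
  rewrite -(stereo_scale _ g1); congr stereo; rewrite [RHS]basis.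
  rewrite /pert /scale /comb /h /=.
  by congr (_, _, _); field; rewrite !gt_eqF.
have U_open : open U.
  have op (f : R * R -> R) : continuous f -> open [set q | 0 < f q].
    by move=> fc; apply: (@open_comp _ _ f [set x : R | 0 < x]) => [q _|]; [exact: fc|exact: open_gt].
  rewrite (_ : U = [set q | 0 < e * ga (lift3 q) - al (lift3 q)] `&`
    [set q | 0 < e * ga (lift3 q) + al (lift3 q)] `&`
    ([set q | 0 < e * ga (lift3 q) - be (lift3 q)] `&`
    [set q | 0 < e * ga (lift3 q) + be (lift3 q)])); last first.
    by apply/seteqP; split=> q; [case|case=> -[? ?] [? ?]].
  have ce : continuous (fun q => e * ga (lift3 q)).
    by move=> q; exact: continuousM (cvg_cst _) (cga q).
  apply: openI; apply: openI; apply: op => q.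
  - exact: continuousB (ce q) (cal q).
  - exact: continuousD (ce q) (cal q).
  - exact: continuousB (ce q) (cbe q).
  - exact: continuousD (ce q) (cbe q).
exists U, h, k; split; last split; last split.
- split=> //.
    rewrite pE -pertP; apply: (kU (0, 0)).
    by apply/sqE => /=; rewrite ltrN10 ltr01.
  apply/seteqP; split=> [z [q Uq <-]|z zs]; first exact: hsq.
  by exists (k z); [exact: kU|exact: kK].
- split=> //.
    apply: continuous_in_subspaceT => q; rewrite inE => /Uga g0.
    have ce : {for q, continuous (fun q => (e * ga (lift3 q))^-1)}.
      apply: cvgV; first by rewrite gt_eqF.
      exact: continuousM (cvg_cst _) (cga q).
    exact: (cvg_pair (continuousM (cal q) ce) (continuousM (cbe q) ce)).
  apply: continuous_in_subspaceT => z; rewrite inE => zs.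
  have aff (x y w : R) :
      {for z, continuous (fun z : R * R => 1 * (1 * x + e * z.1 * y) + e * z.2 * w)}.
    have cst r : {for z, continuous (fun=> r : R)} by exact: cvg_cst.
    have c1 : {for z, continuous (fun z : R * R => z.1)} by exact: cvg_fst.
    have c2 : {for z, continuous (fun z : R * R => z.2)} by exact: cvg_snd.
    exact: (continuousD (continuousM (cst 1) (continuousD
      (continuousM (cst 1) (cst x)) (continuousM (continuousM (cst e) c1) (cst y))))
      (continuousM (continuousM (cst e) c2) (cst w))).
  by apply: (stereo_cts (aff _ _ _) (aff _ _ _) (aff _ _ _)); exact: off_k.
- apply/seteqP; split=> [z [q [[s [t [s0 t0 ->]]] Uq] <-]|z [zs z0]].
    split; first exact: hsq.
    have [l l0 E] := lift3_stereo (offu _ _ s0 t0).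
    by rewrite /h /= E beZ be_u mulr0 mul0r.
  exists (k z); last exact: kK.
  split; last exact: kU.
  exists (a + e * z.1), b; split=> //; last by rewrite /k z0 pert_u.
  by move/sqE: zs => [/andP[? ?] _]; nra.
- apply/seteqP; split=> [z [q [[s [t [s0 t0 ->]]] Uq] <-]|z [zs z0]].
    split; first exact: hsq.
    have [l l0 E] := lift3_stereo (offw _ _ s0 t0).
    by rewrite /h /= E alZ al_w mulr0 mul0r.
  exists (k z); last exact: kK.
  split; last exact: kU.
  exists (c + e * z.2), d; split=> //; last by rewrite /k z0 pert_w.
  by move/sqE: zs => [_ /andP[? ?]]; nra.
Qed.
End Arcs.

(** * The rays of the vertices *)

Section Rays.
Local Open Scope ring_scope.
Local Open Scope classical_set_scope.
Variables (R : realType) (n : nat).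
Implicit Types (p q r s : ('I_n * 'I_2)%type) (a b c d x y z : R).

Definition param (i : nat) : R := (tower i)%:~R.
Definition moment x : R * R * R := (1, x, x ^+ 2).
Definition par p : bool := odd p.1 (+) odd p.2.
Definition ray p := scale ((-1) ^+ par p) (moment (param p.1)).
(* [plane x y] vanishes on the plane spanned by [moment x] and [moment y]. *)
Definition plane x y (v : R * R * R) := v.2 - (x + y) * v.1.2 + x * y * v.1.1.

Lemma param_lt i j : (param i < param j) = (i < j)%N.
Proof. by rewrite /param ltr_int tower_lt. Qed.

Lemma param_neq i j : (param i - param j != 0) = (i != j).
Proof. by rewrite subr_eq0 /param eqr_int (inj_eq tower_inj). Qed.

Lemma plane_moment x y z : plane x y (moment z) = (z - x) * (z - y).
Proof. by rewrite /plane /=; ring. Qed.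

Lemma plane_scale x y a v : plane x y (scale a v) = a * plane x y v.
Proof. by rewrite /plane /scale /=; ring. Qed.

Lemma plane_comb x y a u b v :
  plane x y (comb a u b v) = a * plane x y u + b * plane x y v.
Proof. by rewrite /plane /comb /=; ring. Qed.

Lemma plane_ray x y p : plane x y (ray p) =
  (-1) ^+ par p * ((param p.1 - x) * (param p.1 - y)).
Proof. by rewrite plane_scale plane_moment. Qed.

Lemma plane_ray0l y p : plane (param p.1) y (ray p) = 0.
Proof. by rewrite plane_ray subrr mul0r mulr0. Qed.

Lemma plane_ray0r x p : plane x (param p.1) (ray p) = 0.
Proof. by rewrite plane_ray subrr !mulr0. Qed.

Lemma plane_ray_neq0 (i j : nat) p : val p.1 != i -> val p.1 != j ->
  plane (param i) (param j) (ray p) != 0.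
Proof. by move=> ni nj; rewrite plane_ray !mulf_neq0 ?signr_eq0 ?param_neq. Qed.

(** The vectors [(1, t_i)] and [(1, t_j)] are independent, so the first two coordinates cannot both
    vanish. Zero coefficients are allowed in order to cover the ends of an edge. *)
Lemma ray_off a b p q : p.1 != q.1 -> 0 <= a -> 0 <= b -> 0 < a + b ->
  off_axis (comb a (ray p) b (ray q)).
Proof.
move=> pq a0 b0 ab; rewrite /off_axis -negb_and; apply/negP.
rewrite /comb /ray /scale /moment /= !mulr1 => /andP[/eqP e1 /eqP e2].
have nd : param p.1 - param q.1 != 0 by rewrite param_neq.
have sn (t : bool) : (-1) ^+ t != 0 :> R by rewrite signr_eq0.
have : a * (-1) ^+ par p * (param p.1 - param q.1) = 0.
  rewrite -[RHS](subrr 0) -{1}e2 -{1}(mul0r (param q.1)) -e1; ring.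
move/eqP; rewrite !mulf_eq0 (negbTE nd) (negbTE (sn _)) !orbF => /eqP a_0.
move/eqP: e1; rewrite a_0 mul0r add0r mulf_eq0 (negbTE (sn _)) orbF => /eqP b_0.
by move: ab; rewrite a_0 b_0 addr0 ltxx.
Qed.

Lemma ray_arc_off p q : p.1 != q.1 -> forall a b, 0 < a -> 0 < b ->
  off_axis (comb a (ray p) b (ray q)).
Proof. by move=> pq a b a0 b0; apply: ray_off; rewrite ?ltW ?addr_gt0. Qed.

Lemma ray_offP p : off_axis (ray p).
Proof. by rewrite /off_axis /ray /scale /= mulr1 signr_eq0. Qed.

(** This is a Vandermonde determinant up to sign. *)
Lemma det_ray p q r : val p.1 != q.1 -> val p.1 != r.1 -> val q.1 != r.1 ->
  dot (ray p) (cross (ray q) (ray r)) != 0.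
Proof.
move=> pq pr qr.
rewrite (_ : dot _ _ = (-1) ^+ par p * (-1) ^+ par q * (-1) ^+ par r *
  ((param q.1 - param p.1) * (param r.1 - param p.1) * (param r.1 - param q.1))).
  by rewrite !mulf_neq0 ?signr_eq0 ?param_neq // eq_sym.
by rewrite /dot /cross /ray /scale /moment /=; ring.
Qed.

Lemma par_inj p q : p.1 = q.1 -> par p = par q -> p = q.
Proof.
case: p q => i [k hk] [j [l hl]] /= ->; rewrite /par /= => /addbI kl.
by congr pair; apply: val_inj => /=; move: k l hk hl kl => [|[|?]] [|[|?]].
Qed.

Lemma sign_pos_inj (s t : bool) a b : 0 < a -> 0 < b ->
  (-1) ^+ s * a = (-1) ^+ t * b -> s = t.
Proof.
by move=> a0 b0; case: s t => [] []; rewrite ?expr0 ?expr1 ?mul1r ?mulN1r //; lra.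
Qed.

(* The open segments of the two edges meet: a linear dependency between four rays. *)
Definition meet p q r s := exists a b c d,
  [/\ 0 < a, 0 < b, 0 < c, 0 < d &
      comb a (ray p) b (ray q) = comb c (ray r) d (ray s)].

Lemma meetC p q r s : meet p q r s -> meet q p r s.
Proof.
move=> [a [b [c [d [a0 b0 c0 d0 E]]]]]; exists b, a, c, d; split=> //.
by rewrite -E /comb; congr (_, _, _); rewrite addrC.
Qed.

Lemma meet_sym p q r s : meet p q r s -> meet r s p q.
Proof.
by move=> [a [b [c [d [a0 b0 c0 d0 E]]]]]; exists c, d, a, b; split.
Qed.

(** If [q] and [s] were in different columns, the functional with roots at the columns of [p] and
    [s] would kill [p], [r] and [s] but not [q]. *)
Lemma meet_shared p q r s : p.1 != q.1 -> meet p q r s -> p.1 = r.1 -> q.1 = s.1.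
Proof.
move=> pq [a [b [c [d [a0 b0 c0 d0 E]]]]] pr; apply/eqP/negPn/negP => qs.
have := congr1 (plane (param p.1) (param s.1)) E.
rewrite !plane_comb plane_ray0l plane_ray0r pr plane_ray0l !mulr0 !add0r.
move/eqP; rewrite mulf_eq0 gt_eqF //=; apply/negP.
by apply: plane_ray_neq0; rewrite // -pr eq_sym.
Qed.

(** With a double root at the common column of [q] and [s], the functional is a square on the moment
    curve, so [p] and [r] must carry the same sign; antipodal copies are excluded. *)
Lemma meet_same p q r s : p.1 != q.1 -> meet p q r s -> p.1 = r.1 -> p = r.
Proof.
move=> pq m pr; apply: par_inj => //.
have qs := meet_shared pq m pr.
have [a [b [c [d [a0 b0 c0 d0 E]]]]] := m.
have := congr1 (plane (param q.1) (param q.1)) E.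
rewrite !plane_comb plane_ray0l qs plane_ray0l !mulr0 !addr0 !plane_ray pr.
have h : 0 < (param r.1 - param s.1) * (param r.1 - param s.1).
  by rewrite -expr2 exprn_even_gt0 //= param_neq -pr -qs.
rewrite !(mulrCA _ (_ ^+ _)); apply: sign_pos_inj; exact: mulr_gt0.
Qed.

(** One shared column forces a second one by [meet_shared], and then [meet_same] identifies the two
    edges. *)
Lemma meet_disjoint p q r s : p.1 != q.1 -> r.1 != s.1 -> meet p q r s ->
  [set p; q]%SET != [set r; s]%SET ->
  uniq [:: val p.1; val q.1; val r.1; val s.1].
Proof.
move=> pq rs m nes.
have mC : meet q p s r.
  by apply: meetC; apply: meet_sym; apply: meetC; apply: meet_sym.
have mC1 : meet q p r s by exact: meetC.
have mC2 : meet p q s r by apply: meet_sym; apply: meetC; apply: meet_sym.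
have qp : q.1 != p.1 by rewrite eq_sym.
have n1 : p.1 != r.1.
  apply/eqP => e; case/eqP: nes.
  by rewrite (meet_same pq m e) (meet_same qp mC (meet_shared pq m e)).
have n2 : p.1 != s.1.
  apply/eqP => e; case/eqP: nes; rewrite finset.setUC.
  by rewrite (meet_same pq mC2 e) (meet_same qp mC1 (meet_shared pq mC2 e)).
have n3 : q.1 != r.1.
  by apply/eqP => e; case/eqP: n2; exact: (meet_shared qp mC1 e).
have n4 : q.1 != s.1.
  by apply/eqP => e; case/eqP: n1; exact: (meet_shared qp mC e).
by rewrite /= !inE !negb_or pq n1 n2 n3 n4 rs.
Qed.

Lemma plane_ray_sign (i j : nat) p : val p.1 != i -> val p.1 != j ->
  exists2 m, 0 < m & plane (param i) (param j) (ray p) =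
    (-1) ^+ (par p (+) (p.1 < i)%N (+) (p.1 < j)%N) * m.
Proof.
have sgnE (k l : nat) : k != l ->
    exists2 m, 0 < m & param k - param l = (-1) ^+ (k < l)%N * m.
  move=> kl; exists `|param k - param l|; first by rewrite normr_gt0 param_neq.
  case: ltngtP kl => // h _.
    by rewrite ltr0_norm ?subr_lt0 ?param_lt // expr1 mulN1r opprK.
  by rewrite gtr0_norm ?subr_gt0 ?param_lt // expr0 mul1r.
move=> /sgnE[m1 m1_0 E1] /sgnE[m2 m2_0 E2]; exists (m1 * m2); first exact: mulr_gt0.
by rewrite plane_ray E1 E2 !signr_addb; move: (par p) => P; ring.
Qed.

(** The functional vanishing at [r] and [s] turns the dependency into a zero sum of positive
    multiples of its values at [p] and [q], which therefore have opposite signs. *)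
Lemma meet_parity p q r s : uniq [:: val p.1; val q.1; val r.1; val s.1] ->
  meet p q r s -> par p (+) (p.1 < r.1)%N (+) (p.1 < s.1)%N =
    ~~ (par q (+) (q.1 < r.1)%N (+) (q.1 < s.1)%N).
Proof.
rewrite /= !inE !negb_or => /and4P[/and3P[pq pr ps] /andP[qr qs] rs _].
move=> [a [b [c [d [a0 b0 c0 d0 E]]]]].
have := congr1 (plane (param r.1) (param s.1)) E.
have [m m0 Em] := plane_ray_sign pr ps; have [k k0 Ek] := plane_ray_sign qr qs.
rewrite !plane_comb plane_ray0l plane_ray0r !mulr0 addr0 Em Ek.
rewrite !(mulrCA _ (_ ^+ _)) => /eqP; rewrite addr_eq0 -mulNr -signrN => /eqP.
by apply: sign_pos_inj; exact: mulr_gt0.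
Qed.

(** The functional vanishing at [q] and [s] leaves [p] and [r] on the two sides of the equation,
    hence with equal signs. *)
Lemma meet_parity_opp p q r s : uniq [:: val p.1; val q.1; val r.1; val s.1] ->
  meet p q r s -> par p (+) (p.1 < q.1)%N (+) (p.1 < s.1)%N =
    par r (+) (r.1 < q.1)%N (+) (r.1 < s.1)%N.
Proof.
rewrite /= !inE !negb_or => /and4P[/and3P[pq pr ps] /andP[qr qs] rs _].
move=> [a [b [c [d [a0 b0 c0 d0 E]]]]].
have := congr1 (plane (param q.1) (param s.1)) E.
have [m m0 Em] := plane_ray_sign pq ps.
have rq : val r.1 != val q.1 by rewrite eq_sym.
have [k k0 Ek] := plane_ray_sign rq rs.
rewrite !plane_comb plane_ray0l plane_ray0r !mulr0 !addr0 Em Ek.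
by rewrite !(mulrCA _ (_ ^+ _)); apply: sign_pos_inj; exact: mulr_gt0.
Qed.

(** The functional vanishing at [r] and [s] fixes the ratio of the coefficients of [p] and [q]. *)
Lemma meet_unique p q r s a b a' b' c d c' d' :
  uniq [:: val p.1; val q.1; val r.1; val s.1] ->
  0 < a -> 0 < a' -> comb a (ray p) b (ray q) = comb c (ray r) d (ray s) ->
  comb a' (ray p) b' (ray q) = comb c' (ray r) d' (ray s) ->
  stereo (comb a (ray p) b (ray q)) = stereo (comb a' (ray p) b' (ray q)).
Proof.
rewrite /= !inE !negb_or => /and4P[/and3P[pq pr ps] /andP[qr qs] rs _] a0 a'0.
move=> /(congr1 (plane (param r.1) (param s.1))) E.
move=> /(congr1 (plane (param r.1) (param s.1))) E'.
move: E E'; rewrite !plane_comb plane_ray0l plane_ray0r !mulr0 addr0.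
have := plane_ray_neq0 pr ps; have := plane_ray_neq0 qr qs.
move: (plane _ _ _) (plane _ _ _) => X Y X0 Y0 E E'.
have ab : a * b' = a' * b.
  apply: (mulIf (mulf_neq0 X0 Y0)); apply/eqP; rewrite -subr_eq0; apply/eqP.
  transitivity (a * (a' * X + b' * Y) * X - a' * (a * X + b * Y) * X); first by ring.
  by rewrite E E' !mulr0 !mul0r subrr.
rewrite -[LHS](@stereo_scale _ a') // -[RHS](@stereo_scale _ a) //; congr stereo.
rewrite /scale /comb /=.
by congr (_, _, _); rewrite !mulrDr !mulrA ab (mulrC a').
Qed.

(** Elimination from the three plane equations gives [D X = 0] and [D Y = 0], where [D] is the
    determinant [concur], nonzero by the growth of the parameters; but [x] is off the axis. *)
Lemma no_triple p q r s (u v : 'I_n * 'I_2) (x : R * R * R) :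
  uniq [:: val p.1; val q.1; val r.1; val s.1; val u.1; val v.1] -> off_axis x ->
  plane (param p.1) (param q.1) x = 0 -> plane (param r.1) (param s.1) x = 0 ->
  plane (param u.1) (param v.1) x = 0 -> False.
Proof.
move=> /tower_concur_neq0; rewrite -(intr_eq0 R).
rewrite /concur !(rmorphD, rmorphN, rmorphM) /= -!/(param _).
move: (param _) (param _) (param _) (param _) (param _) (param _) => f e d c b a.
rewrite /off_axis /plane; move: x.1.1 x.1.2 x.2 => X Y Z D0 XY E1 E2 E3.
set D := (X in X != 0) in D0.
have DX : D * X = 0.
  transitivity ((a + b) * ((Z - (c + d) * Y + c * d * X) - (Z - (e + f) * Y + e * f * X)) +
   (c + d) * ((Z - (e + f) * Y + e * f * X) - (Z - (a + b) * Y + a * b * X)) +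
   (e + f) * ((Z - (a + b) * Y + a * b * X) - (Z - (c + d) * Y + c * d * X))).
    by rewrite /D; ring.
  by rewrite E1 E2 E3 subrr !mulr0 !addr0.
have DY : D * Y = 0.
  transitivity (- (c * d - e * f) * (Z - (a + b) * Y + a * b * X)
    - (e * f - a * b) * (Z - (c + d) * Y + c * d * X)
    - (a * b - c * d) * (Z - (e + f) * Y + e * f * X)); first by rewrite /D; ring.
  by rewrite E1 E2 E3 !mulr0 !subr0.
move: XY; move/eqP: DX; move/eqP: DY.
by rewrite !mulf_eq0 (negbTE D0) /= => -> ->.
Qed.

End Rays.

(** * Enumerating the crossings *)

Section Codes.
Local Open Scope nat_scope.
Variable n : nat.
Implicit Types p q r s : ('I_n * 'I_2)%type.

(** Components come in decreasing order, matching the nested sum of [sum_good4]. *)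
Definition quads : {set 'I_n * ('I_n * ('I_n * 'I_n))} :=
  [set t : 'I_n * ('I_n * ('I_n * 'I_n)) | [&& t.2.1 < t.1, t.2.2.1 < t.2.1, t.2.2.2 < t.2.2.1 &
    good4 (odd t.2.2.2) (odd t.2.2.1) (odd t.2.1) (odd t.1)]]%SET.

Lemma card_quads : #|quads| = \sum_(z < n) \sum_(y < z) \sum_(x < y) \sum_(i < x)
    good4 (odd i) (odd x) (odd y) (odd z).
Proof.
pose F (z y x i : 'I_n) : nat := (y < z) * ((x < y) * ((i < x) *
  good4 (odd i) (odd x) (odd y) (odd z))).
transitivity (\sum_z \sum_y \sum_x \sum_i F z y x i).
  rewrite (eq_bigr (fun z => \sum_t F z t.1 t.2.1 t.2.2)); last first.
    move=> z _; rewrite -(pair_bigA _ (fun y t => F z y t.1 t.2)) /=.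
    by apply: eq_bigr => y _; rewrite -(pair_bigA _ (F z y)).
  rewrite pair_bigA -sum1_card big_mkcond; apply: eq_bigr => -[z [y [x i]]] _.
  by rewrite inE /F /=; do 3!case: (_ < _) => //=; case: good4.
pose g (z y x i : nat) : nat := good4 (odd i) (odd x) (odd y) (odd z).
apply: eq_bigr => z _.
rewrite -(sum_nested_ord (fun y => \sum_(x < y) \sum_(i < x) g z y x i)
  (ltnW (ltn_ord z))).
apply: eq_bigr => y _.
rewrite -(sum_nested_ord (fun x => \sum_(i < x) g z y x i) (ltnW (ltn_ord y))).
rewrite big_distrr; apply: eq_bigr => x _.
by rewrite -(sum_nested_ord (g z y x) (ltnW (ltn_ord x))) !big_distrr.
Qed.

(** The first two components, a side for the least column and a bit, supply the factor four. *)
Definition code := ('I_2 * (bool * ('I_n * ('I_n * ('I_n * 'I_n)))))%type.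

Definition codes : {set code} := finset.setX finset.setT (finset.setX finset.setT quads).

Lemma card_codes : #|codes| =
  (n %/ 2) * ((n - 1) %/ 2) * ((n - 2) %/ 2) * ((n - 3) %/ 2).
Proof.
by rewrite !cardsX !cardsT card_ord card_bool card_quads mulnA sum_good4.
Qed.

(* One edge ends at [i] and [j], the other at [k] and [l]. The parity word tells
   which of [x, y, z] is [l], and [w] tells the other two apart. *)
Definition decode (c : code) : {set {set 'I_n * 'I_2}} :=
  let: (b, (w, (z, (y, (x, i))))) := c in
  let: (l, (u, v)) := if odd x != odd i then (x, (y, z))
    else if odd y == odd i then (y, (x, z)) else (z, (x, y)) in
  let: (j, k) := if w then (v, u) else (u, v) in
  [set [set (i, b); (j, rev_ord b)]; [set (k, b); (l, rev_ord b)]]%SET.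

Lemma ord2_neq (b c : 'I_2) : b != c -> c = rev_ord b.
Proof.
by case: b c => [[|[|?]] ?] [[|[|?]] ?] //= _; apply: val_inj.
Qed.

Variable R : realType.

Ltac parities lem :=
  let h1 := fresh in let h2 := fresh in let h3 := fresh in
  intros h1 h2 h3; apply: lem;
  [| move: h1 h2 h3; do 5!case: (odd _) => //
   | rewrite /decode; move: h1 h2 h3; do 5!case: (odd _) => //].

(** The three sign relations compare the sign of [p] with those of [q], [r] and [s]. For each order
    of the columns they fix all parities relative to that of the least column, so the word is good
    and reveals the position of [s]. *)
Lemma decode_meet p q r s : uniq [:: val p.1; val q.1; val r.1; val s.1] ->
  p.1 < q.1 -> p.1 < r.1 -> p.1 < s.1 -> p.2 != q.2 -> p.2 = r.2 -> q.2 = s.2 ->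
  meet R p q r s ->
  exists2 c, c \in codes & decode c = [set [set p; q]; [set r; s]]%SET.
Proof.
move=> u pq pr ps pq2 pr2 qs2 m.
have h1 := meet_parity u m.
have h2 := meet_parity_opp u m.
have h3 : par p (+) (p.1 < q.1) (+) (p.1 < r.1) =
    par s (+) (s.1 < q.1) (+) (s.1 < r.1).
  apply: (@meet_parity_opp R n p q s r); first by uniq_tac u.
  apply: meet_sym; apply: meetC; exact: meet_sym.
move: h1 h2 h3; rewrite /par -pr2 -qs2 pq pr ps.
have -> : odd q.2 = ~~ odd p.2.
  by rewrite (ord2_neq pq2); case: (p.2) => -[|[|?]].
case: p q r s u pq pr ps pq2 pr2 qs2 {m} => i b [j b'] [k b''] [l b'''] /=.
move=> u ij ik il bb' <- <-; rewrite (ord2_neq bb') => {b'' b''' b' bb'} h1 h2 h3.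
have [jk jl kl] : [/\ val j != k, val j != l & val k != l].
  by move: u; rewrite /= !inE !negb_or => /and4P[_ /andP[? ?] ? _]; split.
(* In each of the six orders of [j], [k], [l] the bit [w] records whether [k < j]. *)
have finish w (x y z : 'I_n) : [&& i < x, x < y & y < z] ->
    good4 (odd i) (odd x) (odd y) (odd z) ->
    decode (b, (w, (z, (y, (x, i))))) =
      [set [set (i, b); (j, rev_ord b)]; [set (k, b); (l, rev_ord b)]]%SET ->
    exists2 c, c \in codes & decode c =
      [set [set (i, b); (j, rev_ord b)]; [set (k, b); (l, rev_ord b)]]%SET.
  move=> /and3P[ix xy yz] g e; exists (b, (w, (z, (y, (x, i))))) => //.
  by rewrite !inE /= ix xy yz g.
move: h1 h2 h3.
have [hjk|hjk|e] := ltngtP j k; last by move: jk; rewrite /= e eqxx.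
  have [hjl|hjl|e] := ltngtP j l; last by move: jl; rewrite /= e eqxx.
    have [hkl|hkl|e] := ltngtP k l; last by move: kl; rewrite /= e eqxx.
      by parities (finish false j k l); rewrite ij hjk.
    by parities (finish false j l k); rewrite ij hjl.
  rewrite (ltn_trans hjl hjk) (ltnNge k) (ltnW (ltn_trans hjl hjk)) /=.
  by parities (finish false l j k); rewrite il hjl.
have [hkl|hkl|e] := ltngtP k l; last by move: kl; rewrite /= e eqxx.
  have [hjl|hjl|e] := ltngtP j l; last by move: jl; rewrite /= e eqxx.
    by parities (finish true k j l); rewrite ik hjk.
  by parities (finish true k l j); rewrite ik hkl.
rewrite (ltn_trans hkl hjk) (ltnNge j) (ltnW (ltn_trans hkl hjk)) /=.
by parities (finish true l k j); rewrite il hkl.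
Qed.

End Codes.

(** * The drawing *)

Section Drawing.
Local Open Scope classical_set_scope.
Local Open Scope ring_scope.
Variables (R : realType) (n : nat).
Let G := kronecker (complete_graph n) (path_graph 2).
Implicit Types (p q r s : ('I_n * 'I_2)%type) (e f g : {set G}) (x : R * R).

Lemma adj_kroneckerE p q : @adj G p q = (p.1 != q.1) && (p.2 != q.2).
Proof.
rewrite /= /kronecker_adj /=; congr (_ && _).
by case: p q => p1 [[|[|?]] ?] [q1 [[|[|?]] ?]].
Qed.

(** [pick] chooses an orientation of the edge; the default is reached only outside [edges G]. *)
Definition edge_curve e (t : R) : R * R :=
  if [pick pq : G * G | adj pq.1 pq.2 && (e == [set pq.1; pq.2]%SET)] is Some pq
  then stereo (comb (1 - t) (ray R pq.1) t (ray R pq.2)) else 0.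

Lemma edge_curveP e : e \in edges G -> exists p q,
  [/\ p.1 != q.1, p.2 != q.2, e = [set p; q]%SET &
    edge_curve e = (fun t => stereo (comb (1 - t) (ray R p) t (ray R q)))].
Proof.
move=> /imsetP[[p q]]; rewrite inE /= => pq ee.
rewrite /edge_curve; case: pickP => [[u v] /= /andP[uv /eqP euv]|/(_ (p, q))].
  have /andP[h1 h2] : (u.1 != v.1) && (u.2 != v.2).
    by rewrite -adj_kroneckerE; exact: uv.
  by exists u, v.
by rewrite ee eqxx andbT => npq; case/idP: npq; exact: pq.
Qed.

Lemma edge_arc e p q :
    edge_curve e = (fun t => stereo (comb (1 - t) (ray R p) t (ray R q))) ->
  edge_curve e @` `]0, 1[ = arc (ray R p) (ray R q).
Proof. by move=> ->; exact: arc_segment. Qed.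

Lemma arc_dependency p q r s x : p.1 != q.1 -> r.1 != s.1 ->
  arc (ray R p) (ray R q) x -> arc (ray R r) (ray R s) x ->
  exists a b c d, [/\ 0 < a, 0 < b, 0 < c, 0 < d &
    x = stereo (comb a (ray R p) b (ray R q)) /\
    comb a (ray R p) b (ray R q) = comb c (ray R r) d (ray R s)].
Proof.
move=> pq rs [a [b [a0 b0 ->]]] [c [d [c0 d0]]].
move=> /(stereo_eq (ray_arc_off pq a0 b0) (ray_arc_off rs c0 d0))[l l0 E].
exists a, b, (l * c), (l * d); rewrite !mulr_gt0 //; split=> //; split=> //.
by rewrite E /scale /comb /=; congr (_, _, _); ring.
Qed.

Lemma arc_meet p q r s x : p.1 != q.1 -> r.1 != s.1 ->
  arc (ray R p) (ray R q) x -> arc (ray R r) (ray R s) x -> meet R p q r s.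
Proof.
move=> pq rs xe xf.
have [a [b [c [d [a0 b0 c0 d0 [_ E]]]]]] := arc_dependency pq rs xe xf.
by exists a, b, c, d; split.
Qed.

Lemma edges_meet e f x : e \in edges G -> f \in edges G -> e != f ->
  (edge_curve e @` `]0, 1[) x -> (edge_curve f @` `]0, 1[) x ->
  exists p q r s, [/\ e = [set p; q]%SET, f = [set r; s]%SET, p.2 != q.2,
    r.2 != s.2 & [/\ arc (ray R p) (ray R q) x, arc (ray R r) (ray R s) x,
    meet R p q r s & uniq [:: val p.1; val q.1; val r.1; val s.1]]].
Proof.
move=> /edge_curveP[p [q [pq1 pq2 eE /edge_arc eA]]].
move=> /edge_curveP[r [s [rs1 rs2 fE /edge_arc fA]]] ef.
rewrite eA fA => xe xf; exists p, q, r, s; split=> //.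
have m := arc_meet pq1 rs1 xe xf.
by split=> //; apply: meet_disjoint m _ => //; rewrite -eE -fE.
Qed.

Lemma edges_meet_unique e f x y : e \in edges G -> f \in edges G -> e != f ->
  (edge_curve e @` `]0, 1[) x -> (edge_curve f @` `]0, 1[) x ->
  (edge_curve e @` `]0, 1[) y -> (edge_curve f @` `]0, 1[) y -> x = y.
Proof.
move=> /edge_curveP[p [q [pq1 pq2 eE /edge_arc eA]]].
move=> /edge_curveP[r [s [rs1 rs2 fE /edge_arc fA]]] ef.
rewrite eA fA => xe xf.
have m := arc_meet pq1 rs1 xe xf.
have u : uniq [:: val p.1; val q.1; val r.1; val s.1].
  by apply: meet_disjoint m _ => //; rewrite -eE -fE.
have [a [b [c [d [a0 _ _ _ [-> E]]]]]] := arc_dependency pq1 rs1 xe xf.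
move=> ye yf.
have [a' [b' [c' [d' [a'0 _ _ _ [-> E']]]]]] := arc_dependency pq1 rs1 ye yf.
exact: meet_unique u a0 a'0 E E'.
Qed.

Definition point (p : G) : R * R := stereo (ray R p).

(** A functional with a double root separates distinct columns; the sign of the first coordinate
    separates the two copies in one column. *)
Lemma point_inj : injective point.
Proof.
move=> p q /(stereo_eq (ray_offP R p) (ray_offP R q))[l l0 E].
have pq1 : p.1 = q.1.
  apply/eqP/negPn/negP => pq.
  have := congr1 (plane (param R q.1) (param R q.1)) E.
  rewrite plane_scale plane_ray0l mulr0 => /eqP; apply/negP.
  exact: plane_ray_neq0.
apply: par_inj => //; move/(congr1 (fun v => v.1.1)): E.
move=> e; apply: (@sign_pos_inj R _ _ 1 l) => //.
by have : (-1) ^+ par p * 1 = l * ((-1) ^+ par q * 1) := e;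
  move=> ->; rewrite mulr1 mulrC.
Qed.

Lemma edge_curve_cts e : e \in edges G -> {within `[0, 1], continuous (edge_curve e)}.
Proof.
move=> /edge_curveP[p [q [pq _ _ ->]]].
apply: continuous_in_subspaceT => t; rewrite inE /= in_itv /= => /andP[t0 t1].
have cst (a : R) : {for t, continuous (fun=> a : R)} by exact: cvg_cst.
have ct : {for t, continuous (fun s : R => s)} by exact: cvg_id.
have aff (a b : R) : {for t, continuous (fun s : R => (1 - s) * a + s * b)}.
  exact: (continuousD (continuousM (continuousB (cst 1) ct) (cst a))
    (continuousM ct (cst b))).
apply: (stereo_cts (aff _ _) (aff _ _) (aff _ _)).
by apply: ray_off; rewrite ?subr_ge0 // subrK.
Qed.

Lemma edge_curve_inj e : e \in edges G -> {in `[0, 1] &, injective (edge_curve e)}.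
Proof.
move=> /edge_curveP[p [q [pq _ _ ->]]] t s; rewrite !in_itv /=.
move=> /andP[t0 t1] /andP[s0 s1] /stereo_eq[||l l0 E].
- by apply: ray_off; rewrite ?subr_ge0 // subrK.
- by apply: ray_off; rewrite ?subr_ge0 // subrK.
have qp : val q.1 != p.1 by rewrite eq_sym.
(* Double roots at the two ends give [1 - t = l (1 - s)] and [t = l s]; adding these yields
   [l = 1]. *)
have := congr1 (plane (param R q.1) (param R q.1)) E.
have := congr1 (plane (param R p.1) (param R p.1)) E.
rewrite plane_scale plane_scale !plane_comb !plane_ray0l !mulr0 !addr0 !add0r !mulrA.
move=> /(mulIf (plane_ray_neq0 R qp qp)) e1 /(mulIf (plane_ray_neq0 R pq pq)).
rewrite e1 mulrBr mulr1 => e2; have l1 : l = 1 by lra.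
by rewrite l1 mul1r.
Qed.

Lemma edge_curve_ends e : e \in edges G ->
  [set edge_curve e 0; edge_curve e 1] = [set point v | v in [set` e]].
Proof.
move=> /edge_curveP[p [q [pq _ -> ->]]].
have -> : comb (1 - 0) (ray R p) 0 (ray R q) = ray R p.
  by rewrite /comb subr0 !mul1r !mul0r !addr0 -!surjective_pairing.
have -> : comb (1 - 1) (ray R p) 1 (ray R q) = ray R q.
  by rewrite /comb subrr !mul1r !mul0r !add0r -!surjective_pairing.
apply/seteqP; split=> x /=; first by case=> ->; [exists p|exists q];
  rewrite //= !inE eqxx ?orbT.
by move=> [v]; rewrite /= !inE => /orP[/eqP->|/eqP->] <-; [left|right].
Qed.

(** A functional vanishing at the column of [v] and at one end leaves only the other end, with a
    positive coefficient. The end killed is [p] if [v] lies in its column, and [q] otherwise. *)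
Lemma edge_curve_avoids e (v : G) (t : R) : e \in edges G -> t \in `]0, 1[ ->
  edge_curve e t <> point v.
Proof.
move=> /edge_curveP[p [q [pq _ _ ->]]]; rewrite in_itv /= => /andP[t0 t1].
have qp : val q.1 != p.1 by rewrite eq_sym.
have s0 : 0 < 1 - t by rewrite subr_gt0.
move=> /(stereo_eq (ray_arc_off pq s0 t0) (ray_offP R v))[l l0 E].
have [vp|vp] := eqVneq (val v.1) (val p.1).
  have := congr1 (plane (param R v.1) (param R p.1)) E.
  rewrite plane_scale plane_comb plane_ray0l plane_ray0r !mulr0 add0r vp => /eqP.
  by rewrite mulf_eq0 gt_eqF //=; apply/negP; apply: plane_ray_neq0.
have := congr1 (plane (param R v.1) (param R q.1)) E.
rewrite plane_scale plane_comb plane_ray0l plane_ray0r !mulr0 addr0 => /eqP.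
rewrite mulf_eq0 gt_eqF //=; apply/negP; apply: plane_ray_neq0 => //.
by rewrite eq_sym.
Qed.

Lemma edge_curve_transversal e f x : e \in edges G -> f \in edges G -> e != f ->
  (edge_curve e @` `]0, 1[) x -> (edge_curve f @` `]0, 1[) x ->
  crosses_at (edge_curve e @` `]0, 1[) (edge_curve f @` `]0, 1[) x.
Proof.
move=> /edge_curveP[p [q [pq1 pq2 eE /edge_arc eA]]].
move=> /edge_curveP[r [s [rs1 rs2 fE /edge_arc fA]]] ef.
rewrite eA fA => xe xf.
have m := arc_meet pq1 rs1 xe xf.
have : uniq [:: val p.1; val q.1; val r.1; val s.1].
  by apply: meet_disjoint m _ => //; rewrite -eE -fE.
rewrite /= !inE !negb_or => /and4P[/and3P[pq pr ps] /andP[qr qs] rs _].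
apply: arcs_cross => //; [exact: ray_arc_off|exact: ray_arc_off|exact: det_ray].
Qed.

Lemma arc_plane p q x : p.1 != q.1 -> arc (ray R p) (ray R q) x ->
  off_axis (lift3 x) /\ plane (param R p.1) (param R q.1) (lift3 x) = 0.
Proof.
move=> pq [a [b [a0 b0 ->]]].
have o := ray_arc_off pq a0 b0.
have [l l0 ->] := lift3_stereo o; split.
  by move: o; rewrite /off_axis /scale /= !mulf_eq0 (gt_eqF l0).
by rewrite plane_scale plane_comb plane_ray0l plane_ray0r !mulr0 addr0 mulr0.
Qed.

(** Any two of the three edges have disjoint columns, so all six columns are distinct and
    [no_triple] applies to the lifted point. *)
Lemma edge_curve_no_triple e f g x :
  e \in edges G -> f \in edges G -> g \in edges G ->
  e != f -> e != g -> f != g ->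
  (edge_curve e @` `]0, 1[) x -> (edge_curve f @` `]0, 1[) x ->
  ~ (edge_curve g @` `]0, 1[) x.
Proof.
move=> /edge_curveP[p [q [pq1 pq2 eE /edge_arc eA]]].
move=> /edge_curveP[r [s [rs1 rs2 fE /edge_arc fA]]].
move=> /edge_curveP[u [v [uv1 uv2 gE /edge_arc gA]]] ef eg fg.
rewrite eA fA gA => xe xf xg.
have u1 : uniq [:: val p.1; val q.1; val r.1; val s.1].
  by apply: meet_disjoint (arc_meet pq1 rs1 xe xf) _ => //; rewrite -eE -fE.
have u2 : uniq [:: val p.1; val q.1; val u.1; val v.1].
  by apply: meet_disjoint (arc_meet pq1 uv1 xe xg) _ => //; rewrite -eE -gE.
have u3 : uniq [:: val r.1; val s.1; val u.1; val v.1].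
  by apply: meet_disjoint (arc_meet rs1 uv1 xf xg) _ => //; rewrite -fE -gE.
have [offx pe] := arc_plane pq1 xe; have [_ pf] := arc_plane rs1 xf.
have [_ pg] := arc_plane uv1 xg.
have disjoint_ends := introT and3P (And3 u1 u2 u3).
by apply: no_triple offx pe pf pg; uniq_tac disjoint_ends.
Qed.

Definition spherical_drawing : drawing R G :=
  Drawing point_inj edge_curve_cts edge_curve_inj edge_curve_ends
    edge_curve_avoids edge_curve_transversal edge_curve_no_triple.

(** * Bounding the number of crossings of the spherical drawing *)

Lemma meet_decode p q r s : uniq [:: val p.1; val q.1; val r.1; val s.1] ->
  p.2 != q.2 -> r.2 != s.2 -> meet R p q r s ->
  exists2 c, c \in codes n & decode c = [set [set p; q]; [set r; s]]%SET.
Proof.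
(* Exchanging the edges or their ends puts the least column first; exchanging the last two ends then
   places [r'] on the side of [p'], as [decode_meet] requires. *)
have same_side p' q' r' s' : uniq [:: val p'.1; val q'.1; val r'.1; val s'.1] ->
    [&& p'.1 < q'.1, p'.1 < r'.1 & p'.1 < s'.1]%N -> p'.2 != q'.2 -> r'.2 != s'.2 ->
    meet R p' q' r' s' ->
    exists2 c, c \in codes n & decode c = [set [set p'; q']; [set r'; s']]%SET.
  move=> u /and3P[pq pr ps] pq2 rs2 m.
  have [pr2|pr2] := eqVneq p'.2 r'.2.
    apply: (decode_meet u pq pr ps pq2 pr2 _ m).
    by rewrite (ord2_neq pq2) (ord2_neq rs2) pr2.
  have ps2 : p'.2 = s'.2.
    by rewrite (ord2_neq rs2) (ord2_neq pr2) rev_ordK.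
  rewrite [[set r'; s']%SET]finset.setUC.
  apply: (@decode_meet _ R _ _ _ _ _ pq ps pr pq2 ps2); first by uniq_tac u.
    by rewrite (ord2_neq pq2) (ord2_neq pr2).
  by apply: meet_sym; apply: meetC; exact: meet_sym.
move=> u pq rs m.
have : [|| [&& p.1 < q.1, p.1 < r.1 & p.1 < s.1],
    [&& q.1 < p.1, q.1 < r.1 & q.1 < s.1],
    [&& r.1 < s.1, r.1 < p.1 & r.1 < q.1] |
    [&& s.1 < r.1, s.1 < p.1 & s.1 < q.1]]%N.
  move: u; rewrite /=; move: (val p.1) (val q.1) (val r.1) (val s.1).
  by clear => a b c d; rewrite !inE; lia.
case/or4P=> h.
- exact: same_side.
- rewrite [[set p; q]%SET]finset.setUC.
  by apply: same_side => //; [uniq_tac u|rewrite eq_sym|exact: meetC].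
- rewrite finset.setUC.
  by apply: same_side => //; [uniq_tac u|exact: meet_sym].
- rewrite finset.setUC [[set r; s]%SET]finset.setUC.
  apply: same_side => //; [by uniq_tac u|by rewrite eq_sym|].
  by apply: meetC; exact: meet_sym.
Qed.

Lemma crossing_code c : crossings spherical_drawing c ->
  c.1 \in (@decode n @: codes n)%SET.
Proof.
case: c => E x [e [f [[eG fG ef] [/= -> xe xf]]]].
have [p [q [r [s [-> -> pq rs [_ _ m u]]]]]] := edges_meet eG fG ef xe xf.
by have [c cc <-] := meet_decode u pq rs m; exact: imset_f.
Qed.

(** Two edges have at most one common interior point, so counting crossings amounts to counting
    pairs of edges. *)
Lemma crossing_inj c c' : crossings spherical_drawing c ->
  crossings spherical_drawing c' -> c.1 = c'.1 -> c = c'.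
Proof.
case: c c' => E x [E' x'] [e [f [[eG fG ef] [/= -> xe xf]]]].
move=> [e' [f' [[_ _ _] [/= -> xe' xf']]]] EE; congr pair => //.
have on_all g : g \in [set e'; f']%SET -> (edge_curve g @` `]0, 1[) x'.
  by rewrite !inE => /orP[] /eqP->.
by apply: (edges_meet_unique eG fG ef) => //; apply: on_all;
  rewrite -EE !inE eqxx ?orbT.
Qed.

Lemma card_le_nat (T : Type) (A : set T) (h : T -> nat) (m : nat) :
  {in A &, injective h} -> (forall a, A a -> (h a < m)%N) ->
  exists2 k, (k <= m)%N & (A #= `I_k)%card.
Proof.
move=> hinj hm.
have Am : (A #<= `I_m)%card.
  rewrite -(card_le_eql (inj_card_eq hinj)); apply: subset_card_le.
  by move=> _ [a Aa <-]; exact: hm.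
have [k Ak] : finite_set A by apply/finite_set_leP; exists m.
by exists k => //; rewrite -card_le_II -(card_le_eql Ak).
Qed.

Lemma spherical_drawing_crossings : exists2 k,
  (k <= #|codes n|)%N & (crossings spherical_drawing #= `I_k)%card.
Proof.
(* A crossing is numbered by the position of its pair of edges among the decoded codes; an image of
   [codes] has at most [#|codes|] elements. *)
pose s := enum (@decode n @: codes n)%SET.
have [|c /crossing_code|k km kE] :=
  @card_le_nat _ (crossings spherical_drawing) (fun c => index c.1 s) (size s).
- move=> c c'; rewrite !inE => cD c'D E; apply: crossing_inj => //.
  by apply: (index_inj c.1 _ _ E); rewrite /s mem_enum; exact: crossing_code.
- by move=> cc; rewrite index_mem /s mem_enum.
exists k => //; apply: leq_trans km _.
by rewrite /s -cardE leq_imset_card.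
Qed.

End Drawing.

Theorem corollary2p1 (R : realType) (n : nat) (n_ge1 : (1 <= n)%N) :
  (cr R (kronecker (complete_graph n) (path_graph 2)) <=
   ((n %/ 2) * ((n - 1) %/ 2) * ((n - 2) %/ 2) * ((n - 3) %/ 2))%N%:R%:E)%E.
Proof.
have [k km kE] := spherical_drawing_crossings R n.
(* [cr] is an infimum, so this one drawing bounds it. *)
rewrite -card_codes; apply: (@le_trans _ _ k%:R%:E).
  apply: ereal_inf_lbound; exists k => //.
  by exists (spherical_drawing R n).
by rewrite lee_fin ler_nat.
Qed.
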